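(* Let $R$ be a real closed field with natural valuation $v$ and value group $\Gamma$. Let $P_1$ and $P_2$ be distinct orders of the rational function field $R(X)$, let $(A_1,B_1)$ and $(A_2,B_2)$ be the cuts in $R$ corresponding to $P_1$ and $P_2$ respectively, and label them so that $A_1\subsetneq A_2$. Put $$S_i=\{v(b-a): a\in A_i,\ b\in B_i\}\subseteq\Gamma\quad (i=1,2),\qquad U=\{v(a'-a): a,a'\in B_1\cap A_2,\ a<a'\}\subseteq \Gamma .$$ Let $\lambda:\mathcal X(R(X))\to M(R(X))$ be the canonical map sending an order to its associated $\mathbb R$-place. Then: (1) If $S_1\neq S_2$, then $\lambda(P_1)\neq\lambda(P_2)$. (2) If $S_1=S_2=S$ and $S\cap U\neq\emptyset$, then $\lambda(P_1)\neq\lambda(P_2)$. (3) If $S_1=S_2=S$ and $S\cap U=\emptyset$, then $\lambda(P_1)=\lambda(P_2)$.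
   Context: An order $P$ of a field $K$ is identified with its set of positive elements. For an order $P$ of $K$ put $A(P)=\{a\in K:\exists q\in\mathbb Q^+,\ q\pm a\in P\}$, a valuation ring of $K$ with maximal ideal $I(P)=\{a\in K:\forall q\in\mathbb Q^+,\ q\pm a\in P\}$. The residue field $k(P)=A(P)/I(P)$ inherits an Archimedean order from $P$, so it embeds uniquely as an ordered field in $\mathbb R$. The $\mathbb R$-place $\lambda(P):K\to\mathbb R\cup\{\infty\}$ associated to $P$ sends $a\in A(P)$ to its residue class viewed in $\mathbb R$, and $a\notin A(P)$ to $\infty$. $\mathcal X(K)$ is the set of all orders of $K$ and $M(K)$ is the set of all $\mathbb R$-places of $K$. For a real closed field $R$ (with its unique order), the natural valuation $v:R\to\Gamma\cup\{\infty\}$ is the valuation whose valuation ring is $A(\dot R^2)$, where $\dot R^2$ is the set of positive elements of $R$; it is trivial if $R$ is Archimedean. A cut in $R$ is a pair $(A,B)$ with $A\cup B=R$ and $a<b$ for all $a\in A$, $b\in B$; $A$ or $B$ may be empty. The cut corresponding to an order $P$ of $R(X)$ is $A_P=\{a\in R: a<X\}$, $B_P=\{b\in R: b>X\}$ (inequalities with respect to $P$); this gives a bijection between orders of $R(X)$ and cuts in $R$. *)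

(* Defs.v *)
From HB Require Import structures.
From mathcomp Require Import all_boot all_order all_algebra.
From mathcomp Require Import generic_quotient ring_quotient fraction.
From mathcomp Require Import ring lra.
From mathcomp Require Import boolp classical_sets reals.

Set Implicit Arguments.
Unset Strict Implicit.
Unset Printing Implicit Defensive.

Import Order.TTheory GRing.Theory Num.Theory.
Local Open Scope classical_set_scope.
Local Open Scope quotient_scope.
Local Open Scope ring_scope.

(* An order is identified with its set of positive elements; [pos] and [- pos] are disjoint by [posD] and [pos0]. *)
Record field_order (K : fieldType) := Order_ {
  pos :> K -> Prop;
  pos0 : ~ pos 0;
  posD : forall x y, pos x -> pos y -> pos (x + y);
  posM : forall x y, pos x -> pos y -> pos (x * y);
  posVN : forall x, x != 0 -> pos x \/ pos (- x)
}.

#[program] Definition std_order (R : realFieldType) : field_order R :=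
  @Order_ R (fun x => 0 < x) _ (@addr_gt0 R) (@mulr_gt0 R) _.
Next Obligation. by rewrite ltxx. Qed.
Next Obligation.
by move: H; rewrite neq_lt oppr_gt0 => /orP[|] ->; [right|left].
Qed.

(* A copy of [K] carrying the order [P] as a [realFieldType]. *)
Definition ofield (K : fieldType) (P : field_order K) : Type := K.

Section OrderedField.
Context {K : fieldType} (P : field_order K).

Let Rlt (x y : K) : bool := `[< P (y - x) >].
Let Rle (x y : K) := (x == y) || Rlt x y.
Let norm (x : K) := if Rlt x 0 then - x else x.

Let Rlt0 x : Rlt 0 x = `[< P x >]. Proof. by rewrite /Rlt subr0. Qed.
Let Rltx x : Rlt x 0 = `[< P (- x) >]. Proof. by rewrite /Rlt sub0r. Qed.

Let posNN x : P x -> ~ P (- x).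
Proof. by move=> Px PNx; apply: (@pos0 _ P); rewrite -(subrr x); exact: posD. Qed.

Let lt0_add x y : Rlt 0 x -> Rlt 0 y -> Rlt 0 (x + y).
Proof. by rewrite !Rlt0 => /asboolP ? /asboolP ?; apply/asboolP; exact: posD. Qed.

Let lt0_mul x y : Rlt 0 x -> Rlt 0 y -> Rlt 0 (x * y).
Proof. by rewrite !Rlt0 => /asboolP ? /asboolP ?; apply/asboolP; exact: posM. Qed.

Let lt0_ngt0 x : Rlt 0 x -> ~~ Rlt x 0.
Proof. by rewrite Rlt0 Rltx => /asboolP ?; apply/asboolP; exact: posNN. Qed.

Let sub_gt0 x y : Rlt 0 (y - x) = Rlt x y.
Proof. by rewrite Rlt0. Qed.

Let lt0_total x : x != 0 -> Rlt 0 x || Rlt x 0.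
Proof.
by move=> /(@posVN _ P)[] Px; apply/orP; [left|right];
  rewrite ?Rlt0 ?Rltx; exact/asboolP.
Qed.

Let normN x : norm (- x) = norm x.
Proof.
rewrite /norm !Rltx opprK.
case: (asboolP (P x)); case: (asboolP (P (- x))) => //; last first.
  have [->|/(@posVN _ P)[]//] := eqVneq x 0; by rewrite oppr0.
by move=> /[swap] /posNN.
Qed.

Let ge0_norm x : Rle 0 x -> norm x = x.
Proof.
rewrite /Rle /norm => /orP[/eqP <-|/lt0_ngt0/negbTE -> //].
by rewrite oppr0 if_same.
Qed.

HB.instance Definition _ := GRing.Field.on (ofield P).
HB.instance Definition _ := Num.IntegralDomain_isLtReal.Build (ofield P)
  lt0_add lt0_mul lt0_ngt0 sub_gt0 lt0_total normN ge0_norm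
  (fun x y => erefl (Rle x y)).

Lemma posE (x : K) : P x <-> 0 < (x : ofield P).
Proof. by split=> [Px|]; [|rewrite -[x in P x]subr0 => /asboolP]; first
  by apply/asboolP; rewrite subr0. Qed.

End OrderedField.

(* [valring], [valideal] and [resfield] are the A(P), I(P) = the maximal ideal
   of A(P), and k(P) = A(P) / I(P) of the theory of real places. *)

Section ResidueField.
Context {K : fieldType} (P : field_order K).

Definition valring (a : K) : bool :=
  `[< exists q : rat, [/\ 0 < q, P (ratr q + a) & P (ratr q - a)] >].

Lemma valringP (a : K) : reflect
  (exists q : rat, `|a : ofield P| < ratr q) (a \in valring).
Proof.
apply: (iffP (asboolP _)) => [[q [q0 /posE qa /posE qNa]]|[q aq]]; exists q.
  by rewrite ltr_norml; apply/andP; split; lra.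
have q0 : 0 < q.
  by rewrite -(ltr0q (ofield P)); exact: le_lt_trans aq.
by move: aq; rewrite ltr_norml => /andP[? ?]; split => //; apply/posE; lra.
Qed.

Lemma valring_subring : subring_closed valring.
Proof.
split.
- by apply/valringP; exists 2%:R; rewrite normr1 ratr_nat ltr1n.
- move=> a b /valringP[q aq] /valringP[r br]; apply/valringP.
  exists (q + r); rewrite rmorphD.
  by apply: le_lt_trans (ltrD aq br); exact: ler_normB.
- move=> a b /valringP[q aq] /valringP[r br]; apply/valringP.
  by exists (q * r); rewrite rmorphM normrM; apply: ltr_pM.
Qed.

HB.instance Definition _ := GRing.isSubringClosed.Build K valring valring_subring.

Record valring_type := ValRing { valring_val : K; _ : valring_val \in valring }.
HB.instance Definition _ := [isSub for valring_val].
HB.instance Definition _ := [Choice of valring_type by <:].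
HB.instance Definition _ := [SubChoice_isSubComNzRing of valring_type by <:].

Definition valideal (a : valring_type) : bool :=
  `[< forall q : rat, 0 < q -> P (ratr q + val a) /\ P (ratr q - val a) >].

Lemma validealP (a : valring_type) : reflect
  (forall q : rat, 0 < q -> `|val a : ofield P| < ratr q) (a \in valideal).
Proof.
apply: (iffP (asboolP _)) => aI q /aI.
  by move=> [/posE qa /posE qNa]; rewrite ltr_norml; apply/andP; split; lra.
by rewrite ltr_norml => /andP[? ?]; split; apply/posE; lra.
Qed.

Lemma valideal_idealr : idealr_closed valideal.
Proof.
split.
- by apply/validealP => q q0; rewrite rmorph0 normr0 ltr0q.
- by apply/validealP => /(_ 1 ltr01); rewrite rmorph1 normr1 rmorph1 ltxx.
- move=> a u v uI vI; apply/validealP => q q0.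
  have /valringP[r ar] := valP a.
  have r0 : 0 < r by rewrite -(ltr0q (ofield P)); exact: le_lt_trans ar.
  have {}uI : `|val u : ofield P| < ratr (q / 2%:R / r).
    by apply: validealP uI _ _; rewrite !divr_gt0.
  have {}vI : `|val v : ofield P| < ratr (q / 2%:R).
    by apply: validealP vI _ _; rewrite divr_gt0.
  rewrite rmorphD rmorphM; apply: le_lt_trans (ler_normD _ _) _.
  have -> : q = r * (q / 2%:R / r) + q / 2%:R.
    by field; rewrite lt0r_neq0.
  rewrite rmorphD rmorphM; apply: ltrD => //.
  by rewrite normrM; apply: ltr_pM.
Qed.

HB.instance Definition _ := isIdealr.Build valring_type valideal valideal_idealr.

Definition resfield : Type := {ideal_quot (valideal : idealr valring_type)}.
HB.instance Definition _ := GRing.ComNzRing.on resfield.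

Definition residue (a : valring_type) : resfield := \pi_resfield a.

Lemma residue_zmod : zmod_morphism residue.
Proof. exact: rmorphB. Qed.

Lemma residue_monoid : monoid_morphism residue.
Proof. by split=> [|a b]; rewrite /residue ?rmorph1 ?rmorphM. Qed.

HB.instance Definition _ :=
  GRing.isZmodMorphism.Build valring_type resfield residue residue_zmod.
HB.instance Definition _ :=
  GRing.isMonoidMorphism.Build valring_type resfield residue residue_monoid.

Lemma residueB a b : residue (a - b) = residue a - residue b.
Proof. exact: rmorphB. Qed.

Lemma residueM a b : residue (a * b) = residue a * residue b.
Proof. exact: rmorphM. Qed.

Lemma residueD a b : residue (a + b) = residue a + residue b.
Proof. exact: rmorphD. Qed.

Lemma residueN a : residue (- a) = - residue a.
Proof. exact: rmorphN. Qed.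

Lemma residue_surj (x : resfield) : exists a, residue a = x.
Proof. by exists (repr x); rewrite /residue reprK. Qed.

Lemma residue_eq0 (a : valring_type) : (residue a == 0) = (a \in valideal).
Proof.
rewrite -(rmorph0 residue) /residue.
by rewrite -Quotient.idealrBE subr0.
Qed.

Lemma residue_eq0P (a : valring_type) : reflect
  (forall q : rat, 0 < q -> `|val a : ofield P| < ratr q) (residue a == 0).
Proof. by rewrite residue_eq0; exact: validealP. Qed.

Lemma residue_neq0P (a : valring_type) : residue a != 0 ->
  exists2 q : rat, 0 < q & ratr q <= `|val a : ofield P|.
Proof.
move=> /negP a0; apply: contrapT => na; apply/a0/residue_eq0P => q q0.
by rewrite ltNge; apply/negP => qa; apply: na; exists q.
Qed.

Lemma residue_inv (x : resfield) : x != 0 -> exists y, y * x = 1.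
Proof.
have [a <-] := residue_surj x => a0.
have [q q0 qa] := residue_neq0P a0.
have q0' : 0 < ratr q :> ofield P by rewrite ltr0q.
have aV : (val a)^-1 \in valring.
  apply/valringP; exists (q / 2%:R)^-1.
  rewrite normfV fmorphV ltf_pV2 ?posrE ?ltr0q ?divr_gt0 //.
    by apply: lt_le_trans qa; rewrite ltr_rat; lra.
  exact: lt_le_trans qa.
exists (residue (ValRing aV)); rewrite -rmorphM -(rmorph1 residue).
congr residue; apply: val_inj; rewrite rmorphM rmorph1 /= mulVf //.
by rewrite -(@normr_eq0 _ (ofield P)) lt0r_neq0 //; exact: lt_le_trans qa.
Qed.

Let inv (x : resfield) : resfield :=
  if pselect (exists y, y * x = 1) is left h then projT1 (cid h) else 0.

Let mulVf (x : resfield) : x != 0 -> inv x * x = 1.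
Proof.
by move=> /residue_inv; rewrite /inv; case: pselect => // h _; case: cid.
Qed.

Let invr0 : inv 0 = 0.
Proof.
rewrite /inv; case: pselect => // h; exfalso; case: h => y.
by rewrite mulr0 => /eqP; rewrite eq_sym oner_eq0.
Qed.

HB.instance Definition _ := GRing.ComNzRing_isField.Build resfield mulVf invr0.

Definition respos (x : resfield) : Prop :=
  x != 0 /\ exists2 a : valring_type, P (val a) & residue a = x.

Lemma residue_pos (a : valring_type) : respos (residue a) <->
  exists2 q : rat, 0 < q & ratr q <= (val a : ofield P).
Proof.
split=> [[a0 [b Pb ba]]|[q q0 qa]].
  have [q q0 qb] := residue_neq0P a0; rewrite -ba in a0.
  have [r r0 rb] := residue_neq0P a0.
  exists (r / 2%:R); first by rewrite divr_gt0.
  have /residue_eq0P : residue (b - a) == 0.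
    by rewrite residueB ba subrr.
  move=> /(_ (r / 2%:R)); rewrite divr_gt0 // => /(_ isT).
  move/posE: Pb => Pb; move: rb; rewrite gtr0_norm // => rb.
  rewrite ltr_norml rmorphB => /andP[_].
  by rewrite rmorphM fmorphV rmorph_nat; lra.
split; last first.
  by exists a => //; apply/posE; apply: lt_le_trans qa; rewrite ltr0q.
apply/negP => /residue_eq0P/(_ _ q0); rewrite ltNge => /negP; apply.
by apply: le_trans qa _; exact: ler_norm.
Qed.


Lemma respos0 : ~ respos 0.
Proof. by case; rewrite eqxx. Qed.

Lemma resposD x y : respos x -> respos y -> respos (x + y).
Proof.
have [[a <-] [b <-]] := (residue_surj x, residue_surj y).
rewrite -residueD => /residue_pos[q q0 qa] /residue_pos[r r0 rb].
apply/residue_pos; exists (q + r); first exact: addr_gt0.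
by rewrite !rmorphD lerD.
Qed.

Lemma resposM x y : respos x -> respos y -> respos (x * y).
Proof.
have [[a <-] [b <-]] := (residue_surj x, residue_surj y).
rewrite -residueM => /residue_pos[q q0 qa] /residue_pos[r r0 rb].
apply/residue_pos; exists (q * r); first exact: mulr_gt0.
by rewrite !rmorphM; apply: ler_pM => //; rewrite ler0q ltW.
Qed.

Lemma resposVN x : x != 0 -> respos x \/ respos (- x).
Proof.
have [a <-] := residue_surj x => /residue_neq0P[q q0].
rewrite ler_normr -rmorphN => /orP[] qa; [left|right];
  by rewrite -?residueN; apply/residue_pos; exists q.
Qed.

Definition resorder : field_order resfield := Order_ respos0 resposD resposM resposVN.

Lemma resorder_arch (x : resfield) :
  exists n : nat, (x : ofield resorder) < n%:R.
Proof.
have [a <-] := residue_surj x; have /valringP[q aq] := valP a.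
pose n := (Num.bound `|q|).+1; exists n.
suff : resorder (n%:R - residue a) by move=> /posE; rewrite subr_gt0.
rewrite -(rmorph_nat residue) -residueB.
apply/residue_pos; exists 1 => //.
have qn : q < (Num.bound `|q|)%:R by apply: le_lt_trans (ler_norm q) _; exact: archi_boundP.
rewrite rmorphB rmorph_nat rmorph1 /n -addn1 natrD.
have : ratr q < (Num.bound `|q|)%:R :> ofield P by rewrite -(ratr_nat (ofield P)) ltr_rat.
by move: aq; rewrite ltr_norml => /andP[_]; lra.
Qed.

End ResidueField.

Arguments residue {K} P.
Arguments resfield {K} P.

Section ArchimedeanEmbedding.
Variables (RR : realType) (F : realFieldType).
Hypothesis arch : forall x : F, exists n : nat, x < n%:R.

Let lower (x : F) : set RR := [set ratr q | q in [set q : rat | ratr q < x]].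
Let emb (x : F) : RR := sup (lower x).

Let lower_sup x : has_sup (lower x).
Proof.
split.
  have [n xn] := arch (- x); exists (ratr (- n%:R)); exists (- n%:R) => //=.
  by rewrite rmorphN /= ratr_nat ltrNl.
have [n xn] := arch x; exists n%:R => _ [q /= qx <-].
by rewrite -(ratr_nat RR n) ler_rat -(ler_rat F) ratr_nat ltW // (lt_trans qx).
Qed.

Let emb_gt x q : ratr q < emb x -> ratr q < x.
Proof.
move=> qx; have := lower_sup x => /(@sup_adherent _ _ (emb x - ratr q)).
rewrite subr_gt0 => /(_ qx)[_ [r /= rx <-]]; rewrite subKr ltr_rat => qr.
by apply: lt_trans rx; rewrite ltr_rat.
Qed.

Let emb_lt x q : emb x < ratr q -> x < ratr q.
Proof.
move=> /rat_in_itvoo[r]; rewrite in_itv /= ltr_rat => /andP[xr rq].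
apply: le_lt_trans (_ : ratr r < _); last by rewrite ltr_rat.
rewrite leNgt; apply/negP => rx; move: xr; rewrite ltNge => /negP; apply.
by apply: ub_le_sup; [exact: (lower_sup x).2|exists r].
Qed.

Let emb_gt' x q : ratr q < x -> ratr q <= emb x.
Proof. by move=> qx; rewrite leNgt; apply/negP => /emb_lt; rewrite ltNge ltW. Qed.

Let emb_lt' x q : x < ratr q -> emb x <= ratr q.
Proof. by move=> qx; rewrite leNgt; apply/negP => /emb_gt; rewrite ltNge ltW. Qed.

Let rat_between (x y : RR) : x < y -> exists q, x < ratr q /\ ratr q < y.
Proof. by move=> /rat_in_itvoo[q]; rewrite in_itv /= => /andP[]; exists q. Qed.

Let embD x y : emb (x + y) = emb x + emb y.
Proof.
apply/eqP; rewrite eq_le !leNgt; apply/andP; split; apply/negP => xy.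
- pose d := (emb (x + y) - (emb x + emb y)) / 2%:R.
  have [p [xp pd]] : exists p, emb x < ratr p /\ ratr p < emb x + d.
    by apply: rat_between; rewrite /d; lra.
  have [q [yq qd]] : exists q, emb y < ratr q /\ ratr q < emb y + d.
    by apply: rat_between; rewrite /d; lra.
  have /emb_gt : ratr (p + q) < emb (x + y) by rewrite rmorphD /d in pd qd *; lra.
  have := emb_lt xp; have := emb_lt yq; rewrite rmorphD; lra.
- pose d := (emb x + emb y - emb (x + y)) / 2%:R.
  have [p [xp pd]] : exists p, emb x - d < ratr p /\ ratr p < emb x.
    by apply: rat_between; rewrite /d; lra.
  have [q [yq qd]] : exists q, emb y - d < ratr q /\ ratr q < emb y.
    by apply: rat_between; rewrite /d; lra.
  have /emb_lt : emb (x + y) < ratr (p + q) by rewrite rmorphD /d in xp yq *; lra.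
  have := emb_gt pd; have := emb_gt qd; rewrite rmorphD; lra.
Qed.

Let emb_rat q : emb (ratr q) = ratr q.
Proof.
apply/eqP; rewrite eq_le !leNgt; apply/andP; split; apply/negP.
  by move=> /rat_between[r []]; rewrite ltr_rat => + /emb_gt;
    rewrite ltr_rat => /ltW; rewrite leNgt => /negP.
by move=> /rat_between[r []] /emb_lt; rewrite !ltr_rat => /ltW;
  rewrite leNgt => /negP.
Qed.

Let emb_zmod : zmod_morphism emb.
Proof. by move=> x y; have := embD (x - y) y; rewrite subrK => ->; rewrite addrK. Qed.

Let emb_ge0 x : 0 < x -> 0 <= emb x.
Proof. by rewrite -(rmorph0 (@ratr F)) => /emb_gt'; rewrite rmorph0. Qed.

Let embN x : emb (- x) = - emb x.
Proof.
have := emb_zmod 0 x; rewrite sub0r => ->.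
by rewrite -(rmorph0 (@ratr F)) emb_rat rmorph0 sub0r.
Qed.

Let emb_le x y : x <= y -> emb x <= emb y.
Proof.
rewrite le_eqVlt => /orP[/eqP -> //|]; rewrite -subr_gt0 => /emb_ge0.
by rewrite emb_zmod subr_ge0.
Qed.

Let emb_mulq q x : emb (ratr q * x) = ratr q * emb x.
Proof.
pose eZ := GRing.isZmodMorphism.Build F RR emb emb_zmod.
pose e : {additive F -> RR} := HB.pack emb eZ.
have emz (m : int) y : emb (m%:~R * y) = m%:~R * emb y.
  by rewrite !mulrzl; exact: (raddfMz e).
have d0 : (denq q)%:~R != 0 :> RR by rewrite intr_eq0 denq_eq0.
have d0' : (denq q)%:~R != 0 :> F by rewrite intr_eq0 denq_eq0.
apply: (mulfI d0); rewrite -emz !mulrA /ratr.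
by rewrite ![(denq q)%:~R * _]mulrC !mulfK // emz.
Qed.

Let emb_gt0 x : 0 < x -> 0 < emb x.
Proof.
move=> x0; have [n xn] := arch x^-1.
have n0 : 0 < n%:R :> F by apply: lt_trans xn; rewrite invr_gt0.
apply: (@lt_le_trans _ _ (ratr n%:R^-1)).
  by rewrite ltr0q invr_gt0 ltr0n -(ltr0n F).
by apply: emb_gt'; rewrite fmorphV /= ratr_nat invf_plt.
Qed.

Let embM_gt0 x y : 0 < x -> emb (x * y) = emb x * emb y.
Proof.
move=> x0; have ex0 := emb_gt0 x0.
have lo q : ratr q < y -> ratr q * emb x <= emb (x * y).
  by move=> qy; rewrite -emb_mulq emb_le // [x * y]mulrC ler_pM2r // ltW.
have hi q : y < ratr q -> emb (x * y) <= ratr q * emb x.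
  by move=> qy; rewrite -emb_mulq emb_le // [x * y]mulrC ler_pM2r // ltW.
apply/eqP; rewrite eq_le !leNgt; apply/andP; split; apply/negP.
- rewrite mulrC -ltr_pdivlMr // => /rat_between[q [/emb_lt/hi]].
  by rewrite ltr_pdivlMr // => /le_lt_trans /[apply]; rewrite ltxx.
- rewrite [ltRHS]mulrC -ltr_pdivrMr // => /rat_between[q []].
  rewrite ltr_pdivrMr // => + /emb_gt/lo.
  by move=> /lt_le_trans /[apply]; rewrite ltxx.
Qed.

Let embM x y : emb (x * y) = emb x * emb y.
Proof.
have [x0|x0|->] := ltgtP x 0; last 2 first.
- exact: embM_gt0.
- by have := emb_zmod 0 0; rewrite !subrr mul0r => ->; rewrite mul0r.
by have := @embM_gt0 (- x) y; rewrite oppr_gt0 mulNr !embN mulNr => /(_ x0)/oppr_inj.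
Qed.

Let emb_monoid : monoid_morphism emb.
Proof. by split; [rewrite -(rmorph1 (@ratr F)) emb_rat rmorph1|exact: embM]. Qed.

Lemma arch_embedding : exists e : {rmorphism F -> RR}, forall x, 0 < x -> 0 < e x.
Proof.
pose eZ := GRing.isZmodMorphism.Build F RR emb emb_zmod.
pose eM := GRing.isMonoidMorphism.Build F RR emb emb_monoid.
pose e : {rmorphism F -> RR} := HB.pack emb eZ eM.
exists e => x x0; rewrite lt0r fmorph_eq0 lt0r_neq0 //=; exact: emb_ge0.
Qed.

Lemma arch_embedding_uniq (e1 e2 : {rmorphism F -> RR}) :
  (forall x, 0 < x -> 0 < e1 x) -> (forall x, 0 < x -> 0 < e2 x) -> e1 =1 e2.
Proof.
have aux (f g : {rmorphism F -> RR}) x : (forall x, 0 < x -> 0 < f x) ->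
    (forall x, 0 < x -> 0 < g x) -> f x <= g x.
  move=> f0 g0; rewrite leNgt; apply/negP => /rat_between[q [gq qf]].
  have [xq|qx|xq] := ltgtP x (ratr q).
  - have := f0 (ratr q - x); rewrite subr_gt0 => /(_ xq).
    by rewrite rmorphB fmorph_rat subr_gt0 ltNge ltW.
  - have := g0 (x - ratr q); rewrite subr_gt0 => /(_ qx).
    by rewrite rmorphB fmorph_rat subr_gt0 ltNge ltW.
  - by move: gq; rewrite xq fmorph_rat ltxx.
by move=> e10 e20 x; apply/eqP; rewrite eq_le !aux.
Qed.

End ArchimedeanEmbedding.

Section RPlace.
Context (RR : realType) {K : fieldType} (P : field_order K).

Lemma residue_embedding_ex : exists e : {rmorphism resfield P -> RR},
  forall x, resorder P x -> 0 < e x.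
Proof.
have [e e0] := @arch_embedding RR (ofield (resorder P)) (@resorder_arch K P).
by exists e => x /posE; exact: e0.
Qed.

Definition residue_embedding : {rmorphism resfield P -> RR} :=
  projT1 (cid residue_embedding_ex).

Lemma residue_embeddingP x : resorder P x -> 0 < residue_embedding x.
Proof. exact: projT2 (cid residue_embedding_ex) x. Qed.

Lemma residue_embedding_uniq (e : {rmorphism resfield P -> RR}) :
  (forall x, resorder P x -> 0 < e x) -> e =1 residue_embedding.
Proof.
move=> e0; apply: (@arch_embedding_uniq RR (ofield (resorder P)) e
  residue_embedding) => x /posE; [exact: e0|exact: residue_embeddingP].
Qed.

(* [None] stands for the point at infinity. *)
Definition Rplace (a : K) : option RR :=
  omap (fun a' : valring_type P => residue_embedding (residue P a')) (insub a).

End RPlace.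

HB.mixin Record isOrderedGroup G of Num.POrderedZmodule G := {
  ler_total_group : total (<=%R : rel G);
  lerD2r_group : forall z x y : G, x <= y -> x + z <= y + z
}.

#[short(type="orderedGroupType")]
HB.structure Definition OrderedGroup :=
  {G of isOrderedGroup G & Num.POrderedZmodule G}.

(* Valuations from [K] onto their value group [G], with [None] as infinity. *)
Record valuation (K : fieldType) (G : orderedGroupType) := Valuation_ {
  val_fun :> K -> option G;
  val_infty : forall x, val_fun x = None <-> x = 0;
  val_mul : forall x y g h, val_fun x = Some g -> val_fun y = Some h ->
    val_fun (x * y) = Some (g + h);
  val_add : forall x y g h k, val_fun x = Some g -> val_fun y = Some h ->
    val_fun (x + y) = Some k -> Order.min g h <= k;
  val_onto : forall g, exists x, val_fun x = Some g
}.

Definition valuation_ring (K : fieldType) (G : orderedGroupType)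
    (v : valuation K G) : set K :=
  [set x | v x = None \/ exists2 g, v x = Some g & 0 <= g].

(* This determines [v] up to equivalence of valuations, i.e. up to an order
   isomorphism of the value group. *)
Definition natural_valuation (R : realFieldType) (G : orderedGroupType)
    (v : valuation R G) : Prop :=
  valuation_ring v = [set a | a \in valring (std_order R)].

Section Cuts.
Context {R : rcfType} {G : orderedGroupType}.
Implicit Types (P : field_order {fraction {poly R}}) (v : valuation R G).

Definition cut_lower P : set R := [set a | P (tofrac 'X - tofrac a%:P)].
Definition cut_upper P : set R := [set b | P (tofrac b%:P - tofrac 'X)].

Definition cut_values v P : set G :=
  [set g | exists a b,
    [/\ cut_lower P a, cut_upper P b & v (b - a) = Some g]].

Definition between_values v P1 P2 : set G :=
  [set g | exists a a',
    [/\ (cut_upper P1 `&` cut_lower P2) a, (cut_upper P1 `&` cut_lower P2) a',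
        a < a' & v (a' - a) = Some g]].

End Cuts.

(* Main.v *)
(* Parts (1) and (2) are witnessed by linear functions.  If v(b - a) is in S1,
   with a < X < b at P1, and the places agree, then (X - a)/(b - a) is finite for
   both orders, and its bound at P2 exhibits v(b - a) in S2; the converse
   inclusion uses (b - X)/(b - a).  If a < a' lie between the cuts and
   v(a' - a) = v(b0 - a0) is in S1, then (X - a0)/(a' - a) is finite at P1 and
   its real value at P2, if finite, is larger by at least 1.
   For (3), pick d between the cuts and let y = X - d.  Then e in R, e > 0,
   satisfies e << |y| when v(e) is not in S and |y| << e when v(e) is in S, for
   both orders.  Since R has roots of positive elements, each power y^n with
   n > 0 is infinitely larger or infinitely smaller than every constant, so
   every polynomial in y is one monomial times 1 + infinitesimal, with the same
   monomial for both orders, and the two places agree on quotients. *)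

Require Import Defs.
From mathcomp Require Import all_boot all_order all_algebra.
From mathcomp Require Import generic_quotient ring lra.
From mathcomp Require Import fraction boolp classical_sets reals.

Import Order.TTheory GRing.Theory Num.Theory.
Local Open Scope classical_set_scope.
Local Open Scope ring_scope.

(** * Arithmetic of a real place: values of sums, products, inverses and rationals *)

Section Rplace.
Context (RR : realType) (K : fieldType) (P : field_order K).
Implicit Types (x y : K) (r s : RR).

Lemma Rplace_Some x r : Rplace RR P x = Some r <->
  exists2 a : valring_type P, val a = x & residue_embedding RR P (residue P a) = r.
Proof.
rewrite /Rplace; split.
  by case: insubP => //= a _ ax [ar]; exists a.
by move=> [a <- <-]; rewrite valK.
Qed.

Lemma Rplace_valring x : x \in valring P -> exists r, Rplace RR P x = Some r.
Proof. by move=> xV; rewrite /Rplace insubT /=; eexists. Qed.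

Lemma valring_Rplace {x r} : Rplace RR P x = Some r -> x \in valring P.
Proof. by move=> /Rplace_Some[a <- _]; exact: valP. Qed.

Lemma Rplace1 : Rplace RR P 1 = Some 1.
Proof. by apply/Rplace_Some; exists 1; rewrite ?rmorph1. Qed.

Lemma RplaceD {x y r s} : Rplace RR P x = Some r -> Rplace RR P y = Some s ->
  Rplace RR P (x + y) = Some (r + s).
Proof.
move=> /Rplace_Some[a <- <-] /Rplace_Some[b <- <-].
by apply/Rplace_Some; exists (a + b); rewrite ?rmorphD.
Qed.

Lemma RplaceM {x y r s} : Rplace RR P x = Some r -> Rplace RR P y = Some s ->
  Rplace RR P (x * y) = Some (r * s).
Proof.
move=> /Rplace_Some[a <- <-] /Rplace_Some[b <- <-].
by apply/Rplace_Some; exists (a * b); rewrite ?rmorphM.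
Qed.

Lemma rat_valring (q : rat) : ratr q \in valring P.
Proof.
apply/valringP; exists (`|q| + 1); rewrite ltr_norml -rmorphN !ltr_rat.
by rewrite -ltr_norml ltrDl.
Qed.

(** Multiplying by the denominator reduces this to integers, which every ring morphism fixes. *)
Lemma Rplace_rat (q : rat) : Rplace RR P (ratr q) = Some (ratr q).
Proof.
have qV := rat_valring q.
apply/Rplace_Some; exists (ValRing qV) => //.
have d0 (F : numFieldType) : (denq q)%:~R != 0 :> F by rewrite intr_eq0 denq_eq0.
have dP : (denq q)%:~R != 0 :> K by exact: d0 (ofield P).
have : ValRing qV * (denq q)%:~R = (numq q)%:~R.
  by apply: val_inj; rewrite rmorphM !rmorph_int /= /ratr divfK.
move=> /(congr1 (residue_embedding RR P \o residue P)) /=.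
rewrite !rmorphM !rmorph_int => qE.
by apply: (mulIf (d0 RR)); rewrite qE /ratr divfK ?d0.
Qed.

Lemma Rplace0P x : Rplace RR P x = Some 0 <->
  forall q : rat, 0 < q -> `|x : ofield P| < ratr q.
Proof.
split=> [/Rplace_Some[a <- /eqP]|xq].
  by rewrite fmorph_eq0 => /residue_eq0P.
have xV : x \in valring P by apply/valringP; exists 1; exact: xq.
apply/Rplace_Some; exists (ValRing xV) => //.
by apply/eqP; rewrite fmorph_eq0; apply/residue_eq0P.
Qed.

Lemma Rplace_le x y r s : Rplace RR P x = Some r -> Rplace RR P y = Some s ->
  (x : ofield P) <= y -> r <= s.
Proof.
move=> /Rplace_Some[a <- <-] /Rplace_Some[b <- <-].
rewrite le_eqVlt => /orP[/eqP/val_inj -> //|ab].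
rewrite -subr_ge0 -rmorphB -residueB.
have [->|ba0] := eqVneq (residue P (b - a)) 0; first by rewrite rmorph0.
apply/ltW/residue_embeddingP; split => //; exists (b - a) => //.
by apply/posE; rewrite rmorphB subr_gt0.
Qed.

(** A nonzero residue keeps [|x|] above a positive rational, so the inverse is finite; its value
    then follows from multiplicativity. *)
Lemma RplaceV {x r} : r != 0 -> Rplace RR P x = Some r ->
  Rplace RR P x^-1 = Some r^-1.
Proof.
move=> r0 xr; have /Rplace_Some[a ax ar] := xr.
have ra0 : residue P a != 0 by rewrite -(fmorph_eq0 (residue_embedding RR P)) ar.
have [q q0 qx] := residue_neq0P ra0; rewrite ax in qx.
have xq0 : 0 < `|x : ofield P| by apply: lt_le_trans qx; rewrite ltr0q.
have x0 : x != 0 by rewrite -(@normr_gt0 _ (ofield P)).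
have [s xs] : exists s, Rplace RR P x^-1 = Some s.
  apply: Rplace_valring; apply/valringP; exists (q^-1 + 1).
  rewrite -[x^-1]/((x : ofield P)^-1) normfV.
  apply: (@le_lt_trans _ _ (ratr q^-1)); last by rewrite ltr_rat ltrDl.
  by rewrite fmorphV lef_pV2 ?posrE ?ltr0q.
have := RplaceM xr xs; rewrite divff // Rplace1 => -[rs].
by rewrite xs; congr Some; apply: (mulfI r0); rewrite -rs divff.
Qed.

Lemma RplaceV0 {x} : x != 0 -> Rplace RR P x = Some 0 -> Rplace RR P x^-1 = None.
Proof.
move=> x0 xr; case E: (Rplace RR P x^-1) => [s|//].
have := RplaceM xr E; rewrite divff // Rplace1 mul0r => -[] /eqP.
by rewrite oner_eq0.
Qed.

(** The value of [x] is the real number filling the cut that [x] makes in the rationals. This form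
    mentions only positivity, so it can be carried along maps that respect orders. *)
Lemma RplaceP x r : Rplace RR P x = Some r <->
  forall q : rat, (ratr q < r -> P (x - ratr q)) /\ (r < ratr q -> P (ratr q - x)).
Proof.
have lt_of r' : Rplace RR P x = Some r' -> forall q : rat,
    (ratr q < r' -> P (x - ratr q)) /\ (r' < ratr q -> P (ratr q - x)).
  move=> xr q; split=> qr; apply/posE; rewrite subr_gt0 ltNge; apply/negP.
    by move=> /(Rplace_le _ _ _ _ xr (Rplace_rat q)); rewrite leNgt qr.
  by move=> /(Rplace_le _ _ _ _ (Rplace_rat q) xr); rewrite leNgt qr.
split=> [|xr]; first exact: lt_of.
have [r' xr'] : exists r', Rplace RR P x = Some r'.
  apply: Rplace_valring; apply/valringP.
  have [|p] := @rat_in_itvoo RR (r - 1) r; first by lra.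
  rewrite in_itv /= => /andP[_ /(proj1 (xr p)) /posE px].
  have [|q] := @rat_in_itvoo RR r (r + 1); first by lra.
  rewrite in_itv /= => /andP[/(proj2 (xr q)) /posE qx _].
  exists (`|p| + `|q|); rewrite ltr_norml rmorphD.
  rewrite -[x]/(x : ofield P) in px qx *.
  have : ratr q <= ratr `|q| :> ofield P by rewrite ler_rat ler_norm.
  have : - ratr `|p| <= ratr p :> ofield P.
    by rewrite -rmorphN ler_rat lerNl -normrN ler_norm.
  have : 0 <= ratr `|p| :> ofield P by rewrite ler0q.
  have : 0 <= ratr `|q| :> ofield P by rewrite ler0q.
  by move: px qx; rewrite !subr_gt0 => *; apply/andP; split; lra.
have r'P := lt_of _ xr'.
suff rr : r = r' by rewrite rr.
(* A rational [q] strictly between [r] and [r'] would make both [x - ratr q] and [ratr q - x]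
   positive. *)
apply: contrapT => /eqP; rewrite neq_lt => /orP[] /rat_in_itvoo[q];
  rewrite in_itv /= => /andP[].
  move=> /(proj2 (xr q)) qx /(proj1 (r'P q)) /(posD qx).
  by rewrite addrA subrK subrr => /pos0.
move=> /(proj2 (r'P q)) qx /(proj1 (xr q)) /(posD qx).
by rewrite addrA subrK subrr => /pos0.
Qed.

End Rplace.

(** Since [Q] decides the sign of every nonzero element, a map preserving positivity also reflects
    it; as rationals are fixed, the rational cuts of [x] and [h x] coincide. *)
Lemma Rplace_morph (RR : realType) (L K : fieldType) (Q : field_order L)
    (P : field_order K) (h : {rmorphism L -> K}) :
  (forall x, Q x -> P (h x)) -> forall x, Rplace RR P (h x) = Rplace RR Q x.
Proof.
move=> hQP x.
have hE y : P (h y) <-> Q y.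
  split=> [Phy|]; last exact: hQP.
  have [y0|/(@posVN _ Q)[//|/hQP]] := eqVneq y 0.
    by move: Phy; rewrite y0 rmorph0 => /pos0.
  by rewrite rmorphN => /(posD Phy); rewrite subrr => /pos0.
have hR r : Rplace RR P (h x) = Some r <-> Rplace RR Q x = Some r.
  rewrite !RplaceP; split=> xr q; have := xr q;
    by rewrite -!(fmorph_rat h) -!rmorphB !hE.
case E: (Rplace RR Q x) => [r|]; first exact/hR.
by case F: (Rplace RR P (h x)) => [r|//]; move/hR: F; rewrite E.
Qed.


Lemma fraction_quotient (A : idomainType) (x : {fraction A}) :
  exists f g : A, g != 0 /\ x = tofrac f / tofrac g.
Proof.
elim/quotW: x => a; exists (frac a).1, (frac a).2.
have d0 := denom_ratioP a; split => //.
apply: (mulIf (_ : tofrac (frac a).2 != 0)); first by rewrite tofrac_eq0.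
rewrite divfK ?tofrac_eq0 // -[LHS]/(FracField.mul _ _) !piE.
apply/eqmodP; rewrite /= FracField.equivfE /FracField.mulf.
by rewrite !numer_Ratio ?denom_Ratio ?mulr1 ?mul1r ?oner_eq0 ?mulf_neq0 // mulrC.
Qed.

Lemma valring_or_inv (K : fieldType) (P : field_order K) (x : K) :
  x \in valring P \/ x^-1 \in valring P.
Proof.
have [x1|x1] := lerP `|x : ofield P| 1.
  left; apply/valringP; exists 2%:R; apply: le_lt_trans x1 _.
  by rewrite ratr_nat ltr1n.
right; apply/valringP; exists 1; rewrite rmorph1 -[x^-1]/((x : ofield P)^-1) normfV.
by rewrite invf_lt1 // (lt_trans ltr01).
Qed.

(** Intermediate value theorem for ['X^n - c%:P] on the interval from 0 to [c + 1]: the right end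
    satisfies [(c + 1) ^+ n >= c + 1 > c]. *)
Lemma rcf_root (R : rcfType) (c : R) (n : nat) :
  0 < c -> (0 < n)%N -> exists2 e : R, 0 < e & e ^+ n = c.
Proof.
move=> c0 n0; pose p : {poly R} := 'X^n - c%:P.
have [||e /andP[e0 _] /rootP] := @poly_ivt R p 0 (c + 1).
- by rewrite addr_ge0 ?ltW.
- rewrite !hornerE expr0n gtn_eqF // sub0r oppr_le0 ltW //= subr_ge0.
  have c1 : 1 <= c + 1 by rewrite lerDr ltW.
  by apply: le_trans (_ : c + 1 <= _); rewrite ?lerDl //
    -{1}[c + 1]expr1 ler_weXn2l.
rewrite !hornerE => /eqP; rewrite subr_eq0 => /eqP en.
exists e => //; rewrite lt0r e0 andbT; apply: contraTneq c0 => e00.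
by rewrite -en e00 expr0n gtn_eqF // ltxx.
Qed.

(** * Elements on which two places agree, and polynomials in an element comparable with all
    constants *)

Section SamePlace.
Context (RR : realType) (K : fieldType) (P Q : field_order K).
Implicit Types x z : K.

Definition small x := Rplace RR P x = Some 0 /\ Rplace RR Q x = Some 0.

(** A common value at infinity is excluded, which makes the notion stable under products. *)
Definition same x := exists2 r, Rplace RR P x = Some r & Rplace RR Q x = Some r.

Lemma small_same x : small x -> same x.
Proof. by case; exists 0. Qed.

Lemma small0 : small 0.
Proof. by split; apply/Rplace0P => q q0; rewrite normr0 ltr0q. Qed.

Lemma smallD x z : small x -> small z -> small (x + z).
Proof.
by case=> xP xQ [zP zQ]; split;
  [have := RplaceD _ _ _ xP zP|have := RplaceD _ _ _ xQ zQ]; rewrite addr0.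
Qed.

Lemma smallMr x z : small x -> same z -> small (x * z).
Proof.
by case=> xP xQ [r zP zQ]; split;
  [have := RplaceM _ _ _ xP zP|have := RplaceM _ _ _ xQ zQ]; rewrite mul0r.
Qed.

Lemma sameM x z : same x -> same z -> same (x * z).
Proof. by case=> r ? ? [s ? ?]; exists (r * s); exact: RplaceM. Qed.

Lemma same_add1 x : small x -> same (1 + x).
Proof.
by case=> xP xQ; exists 1; [have := RplaceD _ _ _ (Rplace1 RR K P) xP|
  have := RplaceD _ _ _ (Rplace1 RR K Q) xQ]; rewrite addr0.
Qed.

Lemma same_add1V x : small x -> same (1 + x)^-1.
Proof.
case=> xP xQ; exists 1^-1; apply: RplaceV (oner_neq0 _) _.
  by have := RplaceD _ _ _ (Rplace1 RR K P) xP; rewrite addr0.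
by have := RplaceD _ _ _ (Rplace1 RR K Q) xQ; rewrite addr0.
Qed.

Lemma small_add1_neq0 x : small x -> 1 + x != 0.
Proof.
case=> xP _; apply/eqP => x1; have := RplaceD _ _ _ (Rplace1 RR K P) xP.
by rewrite x1 small0.1 addr0 => -[] /eqP; rewrite eq_sym oner_eq0.
Qed.

Lemma smallX x n : (0 < n)%N -> small x -> small (x ^+ n).
Proof.
case: n => // n _ xs; elim: n => [|n IHn]; first by rewrite expr1.
by rewrite exprS; apply: smallMr xs _; exact: small_same.
Qed.

Lemma smallN x : small x -> small (- x).
Proof.
case=> /Rplace0P xP /Rplace0P xQ; split; apply/Rplace0P => q q0.
  by rewrite -[- x]/(- (x : ofield P)) normrN xP.
by rewrite -[- x]/(- (x : ofield Q)) normrN xQ.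
Qed.

(** A common nonzero value of [x^-1] inverts to a common value of [x]; a common value 0 means that
    both places send [x] to infinity. *)
Lemma eq_Rplace_same x : same x \/ same x^-1 -> Rplace RR P x = Rplace RR Q x.
Proof.
have [->|x0] := eqVneq x 0; first by rewrite small0.1 small0.2.
case=> -[r]; first by move=> -> ->.
have [->|r0] := eqVneq r 0.
  have xV0 : x^-1 != 0 by rewrite invr_eq0.
  by move=> /(RplaceV0 _ _ _ xV0) + /(RplaceV0 _ _ _ xV0); rewrite invrK => -> ->.
by move=> /(RplaceV _ _ _ r0) + /(RplaceV _ _ _ r0); rewrite invrK => -> ->.
Qed.

(** One of [x] and [x^-1] is finite at [P], and the matching equality carries its value to [Q]. *)
Lemma same_eq_Rplace x :
  Rplace RR P x = Rplace RR Q x -> Rplace RR P x^-1 = Rplace RR Q x^-1 ->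
  same x \/ same x^-1.
Proof.
by move=> xE xVE; have [] := valring_or_inv K P x => /(Rplace_valring RR)[r xr];
  [left|right]; exists r; rewrite -?xE -?xVE.
Qed.

Section Transcendental.
Context (R : rcfType) (h : {rmorphism R -> K}) (y : K).
Hypothesis hE : forall c, Rplace RR P (h c) = Rplace RR Q (h c).
Hypothesis y0 : y != 0.
Hypothesis hy : forall e, 0 < e -> small (h e / y) \/ small (y / h e).

(** For positive [c], take an [n]-th root [e] of [c], compare it with [y] by [hy], and raise the
    comparison to the power [n]. *)
Lemma small_monomial c n : c != 0 -> (0 < n)%N ->
  small (h c / y ^+ n) \/ small (y ^+ n / h c).
Proof.
(* Changing the sign of [c] preserves smallness. *)
wlog c0 : c / 0 < c => [wl|_ n0].
  rewrite neq_lt => /orP[c0|c0]; last by apply: wl; rewrite ?gt_eqF.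
  rewrite -oppr_gt0 in c0 => n0.
  have [p|p] := wl _ c0 (lt0r_neq0 c0) n0; [left|right];
    rewrite -[c]opprK rmorphN ?invrN ?mulrN ?mulNr; exact: smallN p.
have [e e0 <-] := rcf_root R c n c0 n0.
by have [/(smallX _ _ n0)|/(smallX _ _ n0)] := hy e e0;
  rewrite expr_div_n rmorphXn; [left|right].
Qed.

(** Induction in Horner form: multiplication by [y] raises the exponent of the dominant monomial,
    and the new constant term is then compared with that monomial. *)
Lemma dominant_monomial (f : {poly R}) : f != 0 -> exists c n e,
  [/\ c != 0, small e & (map_poly h f).[y] = h c * y ^+ n * (1 + e)].
Proof.
elim/poly_ind: f => [|f a IHf]; first by rewrite eqxx.
rewrite rmorphD rmorphM /= map_polyX map_polyC /= !hornerE.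
have [->|/IHf[c [n [e [c0 es ->]]]] _] := eqVneq f 0.
  rewrite mul0r add0r rmorph0 horner0 mul0r add0r polyC_eq0 => a0.
  by exists a, 0%N, 0; split=> //; [exact: small0|rewrite addr0 !mulr1].
have hc0 : h c != 0 by rewrite fmorph_eq0.
have [->|a0] := eqVneq a 0.
  by exists c, n.+1, e; split=> //; rewrite rmorph0 addr0 exprSr; ring.
have ha0 : h a != 0 by rewrite fmorph_eq0.
have yn0 : y ^+ n != 0 by rewrite expf_neq0.
(* If [a] is negligible against [h c * y ^+ n.+1], it is absorbed into the infinitesimal part;
   otherwise [a] dominates and the old polynomial becomes the infinitesimal part. *)
have [ays|yas] := small_monomial _ n.+1 (mulf_neq0 a0 (invr_neq0 c0)) isT.
  exists c, n.+1, (e + h (a / c) / y ^+ n.+1); split => //; first exact: smallD.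
  by rewrite fmorph_div exprSr; field; rewrite hc0 y0 yn0.
exists a, 0%N, (y ^+ n.+1 / h (a / c) * (1 + e)); split => //.
  by apply: smallMr yas _; exact: same_add1.
by rewrite fmorph_div exprSr expr0; field; rewrite hc0 ha0.
Qed.

Lemma eq_Rplace_quotient (f g : {poly R}) : g != 0 ->
  Rplace RR P ((map_poly h f).[y] / (map_poly h g).[y]) =
  Rplace RR Q ((map_poly h f).[y] / (map_poly h g).[y]).
Proof.
have [-> _|/dominant_monomial] := eqVneq f 0.
  by rewrite rmorph0 horner0 mul0r small0.1 small0.2.
move=> [c [n [e [c0 es ->]]]] /dominant_monomial[d [m [e' [d0 es' ->]]]].
apply: eq_Rplace_same.
have hc0 : h c != 0 by rewrite fmorph_eq0.
have hd0 : h d != 0 by rewrite fmorph_eq0.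
have ye k : y ^+ k != 0 by rewrite expf_neq0.
have [e1 e1'] := (small_add1_neq0 _ es, small_add1_neq0 _ es').
have uw : same ((1 + e) / (1 + e')).
  by apply: sameM; [exact: same_add1|exact: same_add1V].
have wu : same ((1 + e') / (1 + e)).
  by apply: sameM; [exact: same_add1|exact: same_add1V].
(* The factors [1 + e] and [1 + e'] have value 1 at both places, so only the ratio of monomials
   matters, in either direction. *)
suff [cd|dc] : same (h c * y ^+ n / (h d * y ^+ m)) \/
    same (h d * y ^+ m / (h c * y ^+ n)).
- by left; rewrite invfM mulrACA; exact: sameM.
- by right; rewrite invf_div invfM mulrACA; exact: sameM.
have cd0 : c / d != 0 by rewrite mulf_neq0 ?invr_neq0.
have dc0 : d / c != 0 by rewrite mulf_neq0 ?invr_neq0.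
(* Unequal exponents leave a constant against a positive power of [y], where one direction is
   infinitesimal; equal exponents leave a constant, covered by [hE]. *)
have [nm|mn|<-] := ltngtP n m.
- have /(small_monomial _ _ cd0) : (0 < m - n)%N by rewrite subn_gt0.
  rewrite -(subnKC (ltnW nm)) addKn exprD fmorph_div.
  by case=> /small_same sxy; [left|right]; move: sxy; congr (same _);
    field; rewrite ?hc0 ?hd0 ?ye.
- have /(small_monomial _ _ dc0) : (0 < n - m)%N by rewrite subn_gt0.
  rewrite -(subnKC (ltnW mn)) addKn exprD fmorph_div.
  by case=> /small_same sxy; [right|left]; move: sxy; congr (same _);
    field; rewrite ?hc0 ?hd0 ?ye.
have -> : h c * y ^+ n / (h d * y ^+ n) = h (c / d).
  by rewrite fmorph_div; field; rewrite hd0 ye.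
have -> : h d * y ^+ n / (h c * y ^+ n) = (h (c / d))^-1.
  by rewrite fmorph_div; field; rewrite hd0 hc0 ye.
by apply: same_eq_Rplace => //; rewrite -fmorphV.
Qed.

End Transcendental.
End SamePlace.

(** * Orders of the rational function field, their cuts, and expansion around a point *)

Section RationalFunctions.
Context (R : rcfType).
Implicit Types (P : field_order {fraction {poly R}}) (a b c : R).

(** Bundled as a ring morphism; [const c] is convertible to [tofrac c%:P], the form occurring in the
    cuts. *)
Definition const : {rmorphism R -> {fraction {poly R}}} :=
  GRing.RMorphism.clone _ _ (@tofrac _ \o polyC) _.

(** Positive elements of a real closed field are nonzero squares, hence positive in every order. *)
Lemma const_gt0 P c : 0 < c -> P (const c).
Proof.
move=> c0; rewrite -[c]sqr_sqrtr ?ltW // expr2 rmorphM.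
have : const (Num.sqrt c) != 0 by rewrite fmorph_eq0 gt_eqF // sqrtr_gt0.
by move=> /(@posVN _ P)[|] sP; [|rewrite -mulrNN]; exact: posM.
Qed.

Lemma const_gt0P P c : P (const c) <-> 0 < c.
Proof.
split; last exact: const_gt0.
move=> Pc; rewrite ltNge le_eqVlt; apply/negP => /orP[/eqP c0|].
  by move: Pc; rewrite c0 rmorph0 => /pos0.
rewrite -oppr_gt0 => /(const_gt0 P); rewrite rmorphN => /(posD Pc).
by rewrite subrr => /pos0.
Qed.

Lemma Rplace_const (RR : realType) P Q c :
  Rplace RR P (const c) = Rplace RR Q (const c).
Proof.
by rewrite !(@Rplace_morph RR R _ (std_order R)) // => x; exact: const_gt0.
Qed.

Lemma lower_or_upper P a : cut_lower P a \/ cut_upper P a.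
Proof.
have : tofrac 'X - tofrac a%:P != 0 by rewrite -rmorphB tofrac_eq0 polyXsubC_eq0.
by move=> /(@posVN _ P)[|]; [left|right; rewrite /cut_upper /= -opprB].
Qed.

Lemma lower_lt_upper P a b : cut_lower P a -> cut_upper P b -> a < b.
Proof.
move=> aP bP; rewrite -subr_gt0 -(const_gt0P P).
by have := posD bP aP; rewrite addrA subrK rmorphB.
Qed.

Lemma lower_le P a b : a <= b -> cut_lower P b -> cut_lower P a.
Proof.
move=> ab bP; have [//|/(lower_lt_upper _ _ _ bP)] := lower_or_upper P a.
by rewrite ltNge ab.
Qed.

Lemma upper_le P a b : a <= b -> cut_upper P a -> cut_upper P b.
Proof.
move=> ab aP; have [bP|//] := lower_or_upper P b.
by have := lower_lt_upper _ _ _ bP aP; rewrite ltNge ab.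
Qed.

Lemma lowerP P a : cut_lower P a <-> (const a : ofield P) < tofrac 'X.
Proof. by rewrite -subr_gt0 -posE. Qed.

Lemma upperP P a : cut_upper P a <-> (tofrac 'X : ofield P) < const a.
Proof. by rewrite -subr_gt0 -posE. Qed.

(** Expansion at [d]: substituting [X + d] and then evaluating at [X - d] cancel, so [f] becomes a
    polynomial in [X - d] over the constants. *)
Lemma tofrac_horner_shift (f : {poly R}) (d : R) :
  (map_poly const (f \Po ('X + d%:P))).[tofrac 'X - const d] = tofrac f.
Proof.
rewrite map_comp_poly horner_comp rmorphD /= map_polyX map_polyC !hornerE subrK.
elim/poly_ind: f => [|f a IHf]; first by rewrite !rmorph0 horner0.
by rewrite !rmorphD !rmorphM /= map_polyX map_polyC !hornerE IHf.
Qed.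

Lemma eq_Rplace_rational (RR : realType) P Q d :
  (forall e, 0 < e -> small RR _ P Q (const e / (tofrac 'X - const d)) \/
     small RR _ P Q ((tofrac 'X - const d) / const e)) ->
  Rplace RR P = Rplace RR Q.
Proof.
move=> sm; apply: funext => x; have [f [g [g0 ->]]] := fraction_quotient _ x.
rewrite -(tofrac_horner_shift f d) -(tofrac_horner_shift g d).
apply: eq_Rplace_quotient => //.
- by move=> c; exact: Rplace_const.
- by rewrite -[const d]/(tofrac d%:P) -rmorphB tofrac_eq0 polyXsubC_eq0.
- apply: contraNneq g0 => gd; rewrite -tofrac_eq0 -(tofrac_horner_shift g d).
  by rewrite gd rmorph0 horner0.
Qed.

End RationalFunctions.

(** * Infinitesimal and finite quotients expressed by inequalities free of division *)

Section Infinitesimal.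
Context (RR : realType) (K : fieldType) (P : field_order K).
Implicit Types x u w : ofield P.

Lemma Rplace_div0 x w : w != 0 ->
  (forall q : rat, 0 < q -> `|x| < ratr q * `|w|) -> Rplace RR P (x / w) = Some 0.
Proof.
move=> w0 xw; apply/Rplace0P => q q0.
by rewrite -[(x / w)%R]/((x : ofield P) / w) normrM normfV
  ltr_pdivrMr ?xw ?normr_gt0.
Qed.

Lemma Rplace_near x u w : 0 < w ->
  (forall q : rat, 0 < q -> u - ratr q * w < x /\ x < u + ratr q * w) ->
  Rplace RR P ((x - u) / w) = Some 0.
Proof.
move=> w0 xu; apply: Rplace_div0 => [|q /xu[ux xu']]; first by rewrite gt_eqF.
by rewrite (gtr0_norm w0) ltr_norml; apply/andP; split; lra.
Qed.

Lemma Rplace_far x u w : 0 < w -> x != u ->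
  (forall q : rat, 0 < q -> x < u - ratr q * w \/ u + ratr q * w < x) ->
  Rplace RR P (w / (x - u)) = Some 0.
Proof.
move=> w0 xu0 xu; apply: Rplace_div0 => [|q q0]; first by rewrite subr_eq0.
rewrite (gtr0_norm w0) mulrC -ltr_pdivrMr ?ltr0q // mulrC -fmorphV ltr_normr.
have /xu[] : 0 < q^-1 by rewrite invr_gt0.
  by move=> ?; apply/orP; right; lra.
by move=> ?; apply/orP; left; lra.
Qed.

End Infinitesimal.

Lemma valring_divP (K : fieldType) (P : field_order K) (x z : K) :
  0 < (z : ofield P) -> x / z \in valring P <->
  exists2 q : rat, 0 < q & `|x : ofield P| < ratr q * (z : ofield P).
Proof.
move=> z0; have xzE : `|(x / z : ofield P)| = `|x : ofield P| / z.
  by rewrite -[x / z]/((x : ofield P) / z) normrM normfV (gtr0_norm z0).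
split=> [/valringP[q]|[q _ xq]].
  rewrite xzE ltr_pdivrMr // => xq; exists q => //.
  by rewrite -(ltr0q (ofield P)) -(pmulr_lgt0 _ z0) (le_lt_trans _ xq).
by apply/valringP; exists q; rewrite xzE ltr_pdivrMr.
Qed.

Lemma valring_div (K : fieldType) (P : field_order K) (x z : ofield P) (q : rat) :
  0 < q -> 0 < z -> 0 < x -> x < ratr q * z -> x / z \in valring P.
Proof.
by move=> q0 z0 x0 xq; apply/valring_divP => //; exists q => //; rewrite gtr0_norm.
Qed.

Lemma Rplace_div_le (RR : realType) (K : fieldType) (P : field_order K)
    (x y w : ofield P) (r s : RR) : 0 < w -> x <= y ->
  Rplace RR P (x / w) = Some r -> Rplace RR P (y / w) = Some s -> r <= s.
Proof.
by move=> w0 xy xr ys; apply: Rplace_le xr ys _; rewrite ler_pM2r ?invr_gt0.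
Qed.

Lemma Rplace_eq_valring (RR : realType) (K : fieldType) (P Q : field_order K) x :
  Rplace RR P = Rplace RR Q -> x \in valring P -> x \in valring Q.
Proof.
by move=> PQ /(Rplace_valring RR)[r]; rewrite PQ => /valring_Rplace.
Qed.

(** * The size of [X - d] against a constant [e], read off from the cut *)

Section ShiftedVariable.
Context (RR : realType) (R : rcfType) (P : field_order {fraction {poly R}}).
Variables (d e : R).
Hypothesis e0 : 0 < e.

Lemma Rplace_shift_near :
  (forall q : rat, 0 < q ->
    cut_lower P (d - ratr q * e) /\ cut_upper P (d + ratr q * e)) ->
  Rplace RR P ((tofrac 'X - const R d) / const R e) = Some 0.
Proof.
move=> de; apply: Rplace_near; first by apply/posE; exact: const_gt0.
by move=> q /de[/lowerP + /upperP]; rewrite rmorphB rmorphD rmorphM fmorph_rat.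
Qed.

Lemma Rplace_shift_far :
  (forall q : rat, 0 < q ->
    cut_upper P (d - ratr q * e) \/ cut_lower P (d + ratr q * e)) ->
  Rplace RR P (const R e / (tofrac 'X - const R d)) = Some 0.
Proof.
move=> de; apply: Rplace_far; first by apply/posE; exact: const_gt0.
  by rewrite -subr_eq0 -[const R d]/(tofrac d%:P) -rmorphB tofrac_eq0 polyXsubC_eq0.
by move=> q /de[/upperP|/lowerP];
  rewrite ?rmorphB ?rmorphD rmorphM fmorph_rat; [left|right].
Qed.

End ShiftedVariable.

(** * The natural valuation and rational bounds *)

Section NaturalValuation.
Context (R : rcfType) (G : orderedGroupType) (v : valuation R G).
Hypothesis v_natural : natural_valuation v.

Lemma val1 : v 1 = Some 0.
Proof.
case E : (v 1) => [g|].
  have := val_mul E E; rewrite mulr1 E => -[/eqP].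
  by rewrite -subr_eq0 opprD addrA subrr sub0r oppr_eq0 => /eqP ->.
by move/val_infty: E => /eqP; rewrite oner_eq0.
Qed.

Lemma val_some x : x != 0 -> exists g, v x = Some g.
Proof.
by case E : (v x) => [g|]; [exists g|move/val_infty: E => ->; rewrite eqxx].
Qed.

Lemma valV x g : v x = Some g -> v x^-1 = Some (- g).
Proof.
move=> xg; have x0 : x != 0.
  by apply/eqP => /(val_infty v); rewrite xg.
have [h xh] := val_some _ (invr_neq0 x0).
have := val_mul xg xh; rewrite divff // val1 => -[gh].
by rewrite xh; congr Some; apply/eqP; rewrite -addr_eq0 addrC -gh.
Qed.

Lemma val_ge0 x g : v x = Some g -> x \in valring (std_order R) -> 0 <= g.
Proof.
move=> xg xA; have : valuation_ring v x by rewrite v_natural.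
by case; rewrite xg // => -[k [->]].
Qed.

(** Both [q] and its inverse lie in the valuation ring, so [v (ratr q)] is 0. Differences may thus
    be rescaled by positive rationals without changing their value. *)
Lemma val_ratM q x g : 0 < q -> v x = Some g -> v (ratr q * x) = Some g.
Proof.
move=> q0 xg; have rV := rat_valring _ (std_order R).
have [h qh] : exists h, v (ratr q) = Some h.
  by apply: val_some; rewrite fmorph_eq0 gt_eqF.
rewrite (val_mul qh xg); congr Some.
have h0 := val_ge0 _ _ qh (rV q).
have := valV _ _ qh; rewrite -fmorphV => /val_ge0 /(_ (rV _)) /(lerD2r_group h).
rewrite add0r addNr => h0'.
by rewrite (_ : h = 0) ?add0r //; apply/le_anti; rewrite h0 h0'.
Qed.

Lemma val_eq_ratio x y g : v x = Some g -> v y = Some g ->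
  exists q : rat, `|x / y| < ratr q.
Proof.
move=> xg yg; have : valuation_ring v (x / y).
  by right; exists 0 => //; have := val_mul xg (valV _ _ yg); rewrite subrr.
rewrite v_natural => /asboolP[q [_ /= qx qNx]].
by exists q; rewrite ltr_norml; apply/andP; split; lra.
Qed.

End NaturalValuation.

Theorem theorem2p4 (RR : realType) (R : rcfType) (Gamma : orderedGroupType)
    (v : valuation R Gamma) (v_natural : natural_valuation v)
    (P1 P2 : field_order {fraction {poly R}}) (P12 : P1 <> P2)
    (A12 : cut_lower P1 `<` cut_lower P2) :
  let S1 := cut_values v P1 in
  let S2 := cut_values v P2 in
  let U := between_values v P1 P2 in
  [/\ S1 <> S2 -> Rplace RR P1 <> Rplace RR P2,
      S1 = S2 -> S1 `&` U !=set0 -> Rplace RR P1 <> Rplace RR P2 &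
      S1 = S2 -> S1 `&` U = set0 -> Rplace RR P1 = Rplace RR P2].
Proof.
move=> S1 S2 U.
have [A1sub A2nsub] := A12.
have A1A2 a : cut_lower P1 a -> cut_lower P2 a by exact: A1sub.
have B2B1 b : cut_upper P2 b -> cut_upper P1 b.
  move=> bB2; have [/A1A2 bA2|//] := lower_or_upper _ P1 b.
  by have := lower_lt_upper _ _ _ _ bA2 bB2; rewrite ltxx.
split.
(* Part (1) by contraposition: equal places force both inclusions between the value sets. *)
- move=> S12 Rp; apply: S12; apply/seteqP; split=> g [a [b [aA bB vg]]];
    have ab := lower_lt_upper _ _ _ _ aA bB; rewrite -subr_gt0 in ab.
    have c0 P := (posE P _).1 (const_gt0 _ P _ ab).
    have := Rplace_eq_valring _ _ _ _
      ((tofrac 'X - const _ a) / const _ (b - a)) Rp.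
    rewrite !valring_divP // => -[].
      exists 1 => //; rewrite rmorph1 mul1r rmorphB.
      by move/lowerP: aA; move/upperP: bB => *; rewrite gtr0_norm; lra.
    move=> q q0; rewrite ltr_norml -(fmorph_rat (const R)) -rmorphM => /andP[_ Xq].
    (* The bound [q] for [(X - a) / (b - a)] at [P2] puts [X] below this second witness, and the
       difference of the witnesses is a rational multiple of [b - a]. *)
    exists a, (a + ratr q * (b - a)); split; first exact: A1A2.
      by apply/upperP; rewrite rmorphD; lra.
    by rewrite addrC addKr (val_ratM _ _ _ v_natural _ _ _ q0 vg).
  have c0 P := (posE P _).1 (const_gt0 _ P _ ab).
  have := Rplace_eq_valring _ _ _ _
    ((const _ b - tofrac 'X) / const _ (b - a)) (esym Rp).
  rewrite !valring_divP // => -[].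
    exists 1 => //; rewrite rmorph1 mul1r rmorphB.
    by move/lowerP: aA; move/upperP: bB => *; rewrite gtr0_norm; lra.
  move=> q q0; rewrite ltr_norml -(fmorph_rat (const R)) -rmorphM => /andP[_ Xq].
  exists (b - ratr q * (b - a)), b; split; last first.
  - by rewrite subKr (val_ratM _ _ _ v_natural _ _ _ q0 vg).
  - exact: B2B1.
  - by apply/lowerP; rewrite rmorphB; lra.
- move=> _ [g [[a0 [b0 [a0A b0B vg]]] [a [a' [[aB aA] [a'B a'A] aa' vg']]]]] Rp.
  have c0 : 0 < a' - a by rewrite subr_gt0.
  have hc0 P := (posE P _).1 (const_gt0 _ P _ c0).
  (* Part (2): equal values give [b0 - a0 < q (a' - a)], so [f] below is finite at [P1], where
     [a0 < X < b0]. *)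
  have [q bq] := val_eq_ratio _ _ _ v_natural _ _ _ vg vg'.
  rewrite ltr_norml in bq; move/andP: bq => [_].
  rewrite ltr_pdivrMr // -subr_gt0 => /(const_gt0 _ P1) /posE bq.
  set f := (tofrac 'X - const _ a0) / const _ (a' - a).
  have q0 : 0 < q.
    rewrite -(ltr0q R) -(pmulr_lgt0 _ c0).
    by have := lower_lt_upper _ _ _ _ a0A b0B; move/posE/const_gt0P: bq; lra.
  move: bq; rewrite rmorphB rmorphM !fmorph_rat rmorphB subr_gt0 => bq.
  move/lowerP: (a0A) => a0X; move/upperP: b0B => Xb0; move/upperP: (aB) => Xa.
  have [r fr1] : exists r, Rplace RR P1 f = Some r.
    apply/Rplace_valring/valring_divP => //; exists q => //.
    by rewrite gtr0_norm; lra.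
  have := fr1; rewrite Rp => fr2.
  have /(valring_divP _ _ _ _ (hc0 P2))[q' q'0] := valring_Rplace _ _ _ fr2.
  move/lowerP: (A1A2 _ a0A) => a0X2; move/lowerP: a'A => a'X; move/lowerP: aA => aX.
  rewrite ltr_norml => /andP[_ Xq'].
  (* The constant [(a - a0) / (a' - a)] has a common value [t]. At [P1], [X < a] gives [r <= t]; at
     [P2], [a' < X] gives [t + 1 <= r], since replacing [a] by [a'] in the numerator adds exactly
     1. *)
  have [t st2] : exists t,
      Rplace RR P2 ((const R a - const R a0) / const R (a' - a)) = Some t.
    have := lower_lt_upper _ _ _ _ a0A aB; rewrite -subr_gt0.
    move=> /(const_gt0 _ P2) /posE; rewrite rmorphB => a0a; apply: Rplace_valring.
    apply: (valring_div _ P2 (const R a - const R a0) _ q') => //.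
    by apply: lt_trans Xq'; rewrite ltrD2r.
  have st1 : Rplace RR P1 ((const R a - const R a0) / const R (a' - a)) = Some t.
    by rewrite Rp.
  have rt : r <= t by apply: Rplace_div_le (hc0 P1) _ fr1 st1; rewrite lerD2r ltW.
  have := RplaceD _ _ _ st2 (Rplace1 RR _ P2).
  have cn0 : const R (a' - a) != 0 by rewrite fmorph_eq0 gt_eqF.
  rewrite -(divff cn0) -mulrDl.
  have -> : const R a - const R a0 + const R (a' - a) = const R a' - const R a0.
    by rewrite -!rmorphB -rmorphD [in LHS]addrC subrKA.
  move=> st2'.
  have : t + 1 <= r.
    by apply: Rplace_div_le (hc0 P2) _ st2' fr2; rewrite lerD2r ltW.
  by lra.
move=> S12 SU.
(* Part (3): strictness of the inclusion of lower cuts supplies [d] between the cuts. *)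
have [d [dA2 dB1]] : exists d, cut_lower P2 d /\ cut_upper P1 d.
  apply: contrapT => nd; apply: A2nsub => a aA2.
  by have [//|aB1] := lower_or_upper _ P1 a; case: nd; exists a.
apply: (@eq_Rplace_rational _ _ _ _ d) => e e0.
have [g vg] : exists g, v e = Some g by apply: val_some; rewrite gt_eqF.
have vq q : 0 < q -> v (ratr q * e) = Some g by move=> q0; exact: val_ratM.
have [gS|gS] := pselect (S1 g); [right|left].
  (* With [g] in [S1], [X] is within every [q e] of [d]: otherwise [d - q e] or [d + q e] would also
     lie between the cuts, putting [g] in [U]. *)
  have gU : ~ U g by move=> gU; have : (S1 `&` U) g by []; rewrite SU.
  split; apply: Rplace_shift_near => // q q0;
    have qe0 : 0 < ratr q * e by rewrite mulr_gt0 ?ltr0q.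
    split; last by apply: upper_le dB1; rewrite lerDl ltW.
    have [//|dqB] := lower_or_upper _ P1 (d - ratr q * e); case: gU.
    have dq : d - ratr q * e < d by rewrite ltrBlDr ltrDl.
    exists (d - ratr q * e), d; split; rewrite ?subKr ?vq //.
    by split=> //; apply: lower_le dA2; exact: ltW.
  split; first by apply: lower_le dA2; rewrite lerBlDr lerDl ltW.
  have [dqA|//] := lower_or_upper _ P2 (d + ratr q * e); case: gU.
  have dq : d < d + ratr q * e by rewrite ltrDl.
  exists d, (d + ratr q * e); split; rewrite // ?[_ + _ - d]addrC ?addKr ?vq //.
  by split=> //; apply: upper_le dB1; exact: ltW.
(* With [g] outside the value sets, no [q e] reaches from [d] across either cut, because such a pair
   would have difference of value [g]. [X] lies below [d] at [P1] and above it at [P2]. *)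
split; apply: Rplace_shift_far => // q q0; [left|right].
  have [dqA|//] := lower_or_upper _ P1 (d - ratr q * e); case: gS.
  by exists (d - ratr q * e), d; split; rewrite ?subKr ?vq.
have [//|dqB] := lower_or_upper _ P2 (d + ratr q * e); case: gS; rewrite S12.
by exists d, (d + ratr q * e); split; rewrite // addrC addKr vq.
Qed.
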